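(* Let $p,q,r$ be integers with $p,q>0$, $\max\{p,q\}\le r$ and $r\leq p+q-1$, and let $(\mathcal{A},m)$ be the multiarrangement in $\mathbb{C}^2$ with defining polynomial $x_1^px_2^q(x_1-x_2)^r$. For $a,b,c\in\mathbb{Z}_{\ge0}$ let \[ \theta_{a,b,c}=\left(\int_0^{x_1}t^c(t-x_1)^b(t-x_2)^a\,dt\right)\partial_1+\left(\int_0^{x_2}t^c(t-x_1)^b(t-x_2)^a\,dt\right)\partial_2 . \] (1) If $p+q+r$ is odd, put $(a,b,c)=\left(\frac{-p+q+r-1}{2},\frac{p-q+r-1}{2},\frac{p+q-r-1}{2}\right)$. Then $\theta_{a,b,c}$ and $\theta_{a,b,c+1}$ form a basis of the $S$-module $D(\mathcal{A},m)$. (2) If $p+q+r$ is even, put $(a,b,c)=\left(\frac{-p+q+r}{2},\frac{p-q+r-2}{2},\frac{p+q-r-2}{2}\right)$ and $(a',b',c')=\left(\frac{-p+q+r-2}{2},\frac{p-q+r}{2},\frac{p+q-r-2}{2}\right)$. Then $x_1\theta_{a,b,c}$ and $x_2\theta_{a',b',c'}$ form a basis of the $S$-module $D(\mathcal{A},m)$.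
   Context: $S=\mathbb{C}[x_1,x_2]$, $\partial_i=\partial/\partial x_i$, $\operatorname{Der}_S=S\partial_1\oplus S\partial_2$. For a multiarrangement $(\mathcal{A},m)$ (linear hyperplanes $H=\ker\alpha_H$ with multiplicities $m(H)$, defining polynomial $\prod_H\alpha_H^{m(H)}$), $D(\mathcal{A},m)=\{\delta\in\operatorname{Der}_S\mid\delta\alpha_H\in(\alpha_H^{m(H)})\ \forall H\}$. Here the hyperplanes are $x_1=0$, $x_2=0$, $x_1-x_2=0$ with multiplicities $p,q,r$. *)

(* Defs.v *)
From HB Require Import structures.
From mathcomp Require Import all_boot all_order all_algebra.
From mathcomp Require Import mpoly.

Set Implicit Arguments.
Unset Strict Implicit.
Unset Printing Implicit Defensive.

Import GRing.Theory Num.Theory.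
Local Open Scope ring_scope.

(** * Formal integration of polynomials in one variable [t]
    over an algebra of characteristic zero *)
Section FormalIntegral.
Variables (K : numFieldType) (A : lalgType K).
Implicit Types (P : {poly A}) (u v : A).

(* The primitive of [P] without constant term. *)
Definition primitive P : {poly A} :=
  \poly_(i < (size P).+1) (if i is j.+1 then (j.+1%:R^-1 : K) *: P`_j else 0).

Definition integral u v P : A := (primitive P).[v] - (primitive P).[u].

Lemma deriv_primitive P : (primitive P)^`() = P.
Proof.
apply/polyP => i; rewrite coef_deriv coef_poly ltnS.
case: ltnP => [_|le_Pi]; last by rewrite mul0rn nth_default.
by rewrite -scaler_nat scalerA divff ?scale1r // pnatr_eq0.
Qed.

Lemma primitive_horner0 P : (primitive P).[0] = 0.
Proof. by rewrite horner_coef0 coef_poly. Qed.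

End FormalIntegral.

(** * Bases of submodules *)
Definition is_basis (S : nzRingType) (M : lmodType S) (D : M -> Prop)
    (n : nat) (e : n.-tuple M) : Prop :=
  [/\ forall i, D (tnth e i),
      forall c : 'I_n -> S,
        \sum_i c i *: tnth e i = 0 -> forall i, c i = 0
    & forall v, D v -> exists c : 'I_n -> S, v = \sum_i c i *: tnth e i].

(** * Logarithmic derivations of plane multiarrangements *)
Section MultiArrangement.
Variable K : numFieldType.
Local Notation S := {mpoly K[2]}.

Definition x1 : S := 'X_0.
Definition x2 : S := 'X_1.

(* The derivation [f1 d/dx1 + f2 d/dx2] is encoded as the row [(f1, f2)] of its
   coefficients in the basis of partial derivatives of Der_S. *)
Definition der_app (delta : 'rV[S]_2) (f : S) : S :=
  \sum_(i < 2) delta 0 i * f^`M(i).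

Lemma der_appX (delta : 'rV[S]_2) (j : 'I_2) : der_app delta 'X_j = delta 0 j.
Proof.
rewrite /der_app (bigD1 j) //= big1 => [|i ne_ij]; rewrite mderivX mnm1E.
  have -> : (U_(j) - U_(j) = 0 :> 'X_{1..2})%MM.
    by apply/mnmP => k; rewrite mnmBE subnn mnm0E.
  by rewrite eqxx scale1r addr0 mpolyX0 mulr1.
by rewrite eq_sym (negPf ne_ij) scale0r mulr0.
Qed.

(* A multiarrangement is the list of its pairs (alpha_H, m(H)), where alpha_H
   is a linear form with kernel H. *)
Definition multiarr := seq (S * nat).

Definition defining_poly (A : multiarr) : S := \prod_(H <- A) H.1 ^+ H.2.

Definition in_principal_ideal (g f : S) : Prop := exists h, f = h * g.

Definition logder (A : multiarr) (delta : 'rV[S]_2) : Prop :=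
  forall H, H \in A -> in_principal_ideal (H.1 ^+ H.2) (der_app delta H.1).

Definition arrA2 (p q r : nat) : multiarr :=
  [:: (x1, p); (x2, q); (x1 - x2, r)].

Lemma defining_poly_arrA2 p q r :
  defining_poly (arrA2 p q r) = x1 ^+ p * x2 ^+ q * (x1 - x2) ^+ r.
Proof. by rewrite /defining_poly !big_cons big_nil /= mulr1 mulrA. Qed.

(* The variable ['X] of [{poly S}] plays the role of t. *)
Definition integrand (a b c : nat) : {poly S} :=
  'X ^+ c * ('X - x1%:P) ^+ b * ('X - x2%:P) ^+ a.

Definition theta (a b c : nat) : 'rV[S]_2 :=
  \row_(i < 2) integral 0 'X_i (integrand a b c).

End MultiArrangement.

(* Main.v *)
(** Saito's criterion: two logarithmic derivations of a multiarrangement form a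
    basis as soon as their coefficient determinant is a nonzero constant multiple
    of the defining polynomial Q.  The determinant of two logarithmic derivations
    is always divisible by Q, the factors of Q being pairwise coprime, so a bound
    on its degree and its nonvanishing suffice.

    Substituting t = u + (v - u) s in an integral from u to v shows that an
    integrand with a root of order m at u and of order n at v yields a multiple of
    (v - u)^(m+n+1), whence theta_{a,b,c} is logarithmic.  The cofactors of x1 and
    x2 restrict on the line x2 = 0 to monomials times beta integrals, which do not
    vanish, and this gives the nonvanishing of the determinant. *)

Require Import Defs.
From mathcomp Require Import all_boot all_order all_algebra.
From mathcomp Require Import reals complex mpoly.
From mathcomp Require Import zify ring.

Set Implicit Arguments.
Unset Strict Implicit.
Unset Printing Implicit Defensive.

Import GRing.Theory Num.Theory.
Local Open Scope ring_scope.

(** * Formal integrals *)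

Section IntegralTheory.
Variables (K : numFieldType) (A : comAlgType K).
Implicit Types (P Q G : {poly A}) (u v c : A).

Lemma coef_primitiveS P i : (primitive P)`_i.+1 = (i.+1%:R^-1 : K) *: P`_i.
Proof.
rewrite coef_poly ltnS; case: ltnP => // le_Pi.
by rewrite nth_default ?scaler0.
Qed.

(** [Q] differs from the primitive of its derivative only by its constant term, which cancels in the
    difference. Linearity, substitution and integration by parts below all reduce to this. *)
Lemma integral_deriv u v Q : integral u v Q^`() = Q.[v] - Q.[u].
Proof.
have -> : Q = primitive Q^`() + (Q`_0)%:P.
  apply/polyP => -[|i]; rewrite coefD coefC /=; first by rewrite coef_poly add0r.
  rewrite coef_primitiveS coef_deriv addr0 -scaler_nat scalerA mulVf ?scale1r //.
  by rewrite pnatr_eq0.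
by rewrite derivD derivC addr0 deriv_primitive /integral !hornerE; ring.
Qed.

Lemma integralZ c u v P : integral u v (c%:P * P) = c * integral u v P.
Proof.
rewrite -{1}[P]deriv_primitive.
have -> : c%:P * (primitive P)^`() = (c%:P * primitive P)^`().
  by rewrite derivM derivC mul0r add0r.
by rewrite integral_deriv !hornerE /integral mulrBr.
Qed.

Lemma integralD u v P Q :
  integral u v (P + Q) = integral u v P + integral u v Q.
Proof.
rewrite -{1}[P]deriv_primitive -{1}[Q]deriv_primitive -derivD integral_deriv.
by rewrite !hornerD /integral; ring.
Qed.

Lemma integral_affine u v P :
  integral u v P =
  (v - u) * integral 0 1 (P \Po (u%:P + (v - u)%:P * 'X)).
Proof.
set L := u%:P + _.
have dL : L^`() = (v - u)%:P.
  by rewrite derivD derivM !derivC derivX mul0r mulr1 !add0r.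
rewrite -integralZ mulrC -dL -{2}[P]deriv_primitive -deriv_comp integral_deriv.
by rewrite !horner_comp /L !(hornerD, hornerM, hornerC, hornerX) mulr0 mulr1 addr0
  [u + _]addrC subrK.
Qed.

Lemma integral_two_roots u v m n G :
  integral u v (('X - u%:P) ^+ m * ('X - v%:P) ^+ n * G) =
  (v - u) ^+ (m + n).+1 *
  integral 0 1 ('X^m * ('X - 1) ^+ n * (G \Po (u%:P + (v - u)%:P * 'X))).
Proof.
rewrite integral_affine exprS -[RHS]mulrA; congr (_ * _).
rewrite -integralZ; congr (integral _ _ _).
rewrite !rmorphM !rmorphXn !rmorphB /= comp_polyX !comp_polyC.
set L := u%:P + _.
have -> : L - u%:P = (v%:P - u%:P) * 'X by rewrite /L; ring.
have -> : L - v%:P = (v%:P - u%:P) * ('X - 1) by rewrite /L; ring.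
by rewrite !exprMn exprD; ring.
Qed.

Lemma integral_two_roots0 v m n G :
  integral 0 v ('X^m * ('X - v%:P) ^+ n * G) =
  v ^+ (m + n).+1 *
  integral 0 1 ('X^m * ('X - 1) ^+ n * (G \Po (v%:P * 'X))).
Proof.
by have := integral_two_roots 0 v m n G; rewrite polyC0 !subr0 add0r.
Qed.

(** Meant for the cofactor of [x1] restricted to x2 = 0, where [u] is [x1]. The unsimplified [0%:P]
    matches the shape left by pushing a morphism through the integral. *)
Lemma integral_betaX u m n k :
  integral 0 1 ('X^m * ('X - 1) ^+ n * (u%:P * 'X - 0%:P) ^+ k) =
  u ^+ k * integral 0 1 ('X^(m + k) * ('X - 1) ^+ n).
Proof.
rewrite -integralZ polyC0 subr0 exprMn exprD rmorphXn /=.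
by congr (integral _ _ _); ring.
Qed.

Lemma integral_betaC u m n k :
  integral 0 1 ('X^m * ('X - 1) ^+ n * (0%:P * 'X - u%:P) ^+ k) =
  (- u) ^+ k * integral 0 1 ('X^m * ('X - 1) ^+ n).
Proof.
by rewrite -integralZ polyC0 mul0r sub0r rmorphXn rmorphN /= mulrC.
Qed.

Lemma deriv_beta m n : ('X ^+ m.+1 * ('X - 1) ^+ n.+1 : {poly A})^`() =
  (m.+1%:R)%:P * ('X^m * ('X - 1) ^+ n.+1)
  + (n.+1%:R)%:P * ('X ^+ m.+1 * ('X - 1) ^+ n).
Proof.
rewrite derivM derivXn deriv_exp derivB derivX derivC subr0 mul1r !rmorphMn /=.
by rewrite mulrnAl mulrnAr !mulr_natl.
Qed.

Lemma beta0 m : m.+1%:R * integral 0 1 ('X^m * ('X - 1) ^+ 0 : {poly A}) = 1.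
Proof.
have := integral_deriv 0 1 ('X ^+ m.+1 : {poly A}).
rewrite derivXn /= -mulr_natl -polyC_natr integralZ expr0 mulr1 => ->.
by rewrite !hornerXn expr1n expr0n subr0.
Qed.

(** Integration by parts: X^(m+1) (X-1)^(n+1) vanishes at both endpoints, so its derivative
    integrates to 0. *)
Lemma betaS m n :
  m.+1%:R * integral 0 1 ('X^m * ('X - 1) ^+ n.+1 : {poly A})
  + n.+1%:R * integral 0 1 ('X ^+ m.+1 * ('X - 1) ^+ n : {poly A}) = 0.
Proof.
rewrite -!integralZ -integralD -deriv_beta integral_deriv.
by rewrite !(hornerM, horner_exp, hornerD, hornerN, hornerX, hornerC) subrr
  !expr0n /= mulr0 mul0r subr0.
Qed.

End IntegralTheory.

(** The image of a primitive under [f] is an antiderivative of the mapped integrand, and any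
    antiderivative computes the integral. *)
Lemma rmorph_formal_integral (K : numFieldType) (A B : comAlgType K)
    (f : {rmorphism A -> B}) u v P :
  f (integral u v P) = integral (f u) (f v) (map_poly f P).
Proof.
rewrite -{2}[P]deriv_primitive -deriv_map integral_deriv !horner_map.
by rewrite /integral rmorphB.
Qed.

Lemma rmorph_integral_two_roots (K : numFieldType) (A B : comAlgType K)
    (f : {rmorphism A -> B}) x y m n k :
  f (integral 0 1 ('X^m * ('X - 1) ^+ n * (('X - y%:P) ^+ k \Po (x%:P * 'X)))) =
  integral 0 1 ('X^m * ('X - 1) ^+ n * ((f x)%:P * 'X - (f y)%:P) ^+ k).
Proof.
rewrite rmorph_formal_integral rmorph0 rmorph1 rmorphXn rmorphB /=.
rewrite comp_polyX comp_polyC !rmorphM !rmorphXn !rmorphB !rmorphM /=.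
by rewrite rmorph1 !map_polyX !map_polyC.
Qed.

(** * Divisibility and degree in two variables *)

Section PlanePolynomials.
Variable K : numFieldType.
Local Notation S := {mpoly K[2]}.
Local Notation x1 := (x1 K).
Local Notation x2 := (x2 K).
Implicit Types f g h x : S.

Lemma mpoly_natSr_neq0 n : n.+1%:R != 0 :> S.
Proof. by rewrite -(rmorph_nat (@mpolyC 2 K)) /= mpolyC_eq0 pnatr_eq0. Qed.

(** Induction on [n] with [m] general, because integration by parts lowers [n] by one at the cost of
    raising [m]. *)
Lemma beta_neq0 m n : integral 0 1 ('X^m * ('X - 1) ^+ n : {poly S}) != 0.
Proof.
elim: n m => [|n IHn] m; apply/eqP => b0.
  by have /eqP := beta0 S m; rewrite b0 mulr0 eq_sym oner_eq0.
have /eqP := betaS S m n; rewrite b0 mulr0 add0r mulf_eq0.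
by rewrite (negPf (mpoly_natSr_neq0 _)) (negPf (IHn _)).
Qed.

Lemma in_principal_idealD x f g : in_principal_ideal x f ->
  in_principal_ideal x g -> in_principal_ideal x (f + g).
Proof. by move=> [h ->] [k ->]; exists (h + k); rewrite mulrDl. Qed.

Lemma in_principal_idealMl x f g :
  in_principal_ideal x g -> in_principal_ideal x (f * g).
Proof. by move=> [h ->]; exists (f * h); rewrite mulrA. Qed.

(** Congruence modulo [x] respects sums and products, so it passes from the variables to every
    polynomial. In particular [x] divides each [f] that the substitution kills. *)
Lemma in_principal_ideal_comp x (t : 2.-tuple S) :
    (forall i, in_principal_ideal x ('X_i - tnth t i)) ->
  forall f, in_principal_ideal x (f - (f \mPo t)).
Proof.
move=> xt; elim/mpolyind => [|c m f _ _ IHf].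
  by rewrite rmorph0 subr0; exists 0; rewrite mul0r.
rewrite comp_mpolyD opprD addrACA; apply: in_principal_idealD => //.
rewrite comp_mpolyZ -scalerBr -mul_mpolyC; apply: in_principal_idealMl.
have congM g g' h h' : in_principal_ideal x (g - g') ->
    in_principal_ideal x (h - h') -> in_principal_ideal x (g * h - g' * h').
  move=> xg xh; have -> : g * h - g' * h' = h * (g - g') + g' * (h - h') by ring.
  by apply: in_principal_idealD; apply: in_principal_idealMl.
rewrite comp_mpolyX mpolyXE_id.
apply: (big_ind2 (fun g g' => in_principal_ideal x (g - g'))) => [|g g' h h'|i _].
- by exists 0; rewrite subrr mul0r.
- exact: congM.
elim: (m i) => [|k IHk]; first by exists 0; rewrite !expr0 subrr mul0r.
by rewrite !exprS; apply: congM.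
Qed.

(* Substituting [t] is reduction modulo [x], so [x] is prime and [g] is prime
   to it. *)
Lemma coprime_principal_ideal x (t : 2.-tuple S) g f n : x != 0 ->
    (forall i, in_principal_ideal x ('X_i - tnth t i)) ->
    x \mPo t = 0 -> g \mPo t != 0 ->
  in_principal_ideal (x ^+ n) f -> in_principal_ideal g f ->
  in_principal_ideal (x ^+ n * g) f.
Proof.
move=> x0 xt ex eg xf [k def_f].
suff [h def_k] : in_principal_ideal (x ^+ n) k.
  by exists h; rewrite def_f def_k mulrA.
case: xf; rewrite def_f {def_f f}.
elim: n => [|n IHn] h e; first by exists k; rewrite expr0 mulr1.
have [|k' def_k] := IHn (h * x); first by rewrite e exprS mulrA.
(* Cancelling the [x ^+ n] already extracted from [k] leaves a single factor [x] to be found in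
   [k']. *)
have {}e : k' * g = h * x.
  have xn0 : x ^+ n != 0 by rewrite expf_neq0.
  by apply: (mulIf xn0); rewrite mulrAC -def_k e exprS mulrA.
have : (k' \mPo t) * (g \mPo t) = 0 by rewrite -rmorphM e rmorphM /= ex mulr0.
move/eqP; rewrite mulf_eq0 (negPf eg) orbF => /eqP ek'.
have := in_principal_ideal_comp xt k'; rewrite ek' subr0 => -[l def_k'].
by exists l; rewrite def_k def_k' exprS mulrA.
Qed.

Lemma mpolyX_neq0 i : 'X_i != 0 :> S.
Proof. by rewrite -msize_poly_eq0 msizeX. Qed.

Definition at_x1_0 : 2.-tuple S := [tuple 0; x2].
Definition at_x2_0 : 2.-tuple S := [tuple x1; 0].

Lemma x1_at_x1_0 : x1 \mPo at_x1_0 = 0. Proof. exact: comp_mpolyXU. Qed.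
Lemma x2_at_x1_0 : x2 \mPo at_x1_0 = x2. Proof. exact: comp_mpolyXU. Qed.
Lemma x1_at_x2_0 : x1 \mPo at_x2_0 = x1. Proof. exact: comp_mpolyXU. Qed.
Lemma x2_at_x2_0 : x2 \mPo at_x2_0 = 0. Proof. exact: comp_mpolyXU. Qed.

Lemma ord2_cases (P : 'I_2 -> Prop) : P 0 -> P 1 -> forall i, P i.
Proof.
move=> P0 P1 [[|[|//]] lti].
  by have -> : Ordinal lti = 0 by apply: val_inj.
by have -> : Ordinal lti = 1 by apply: val_inj.
Qed.

(** The powers are split off one at a time: modulo [x1] the other two factors become a signed power
    of [x2], and modulo [x2] the last one becomes a power of [x1]; neither is zero. *)
Lemma in_principal_ideal_arrA2 p q r f :
    in_principal_ideal (x1 ^+ p) f -> in_principal_ideal (x2 ^+ q) f ->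
    in_principal_ideal ((x1 - x2) ^+ r) f ->
  in_principal_ideal (x1 ^+ p * x2 ^+ q * (x1 - x2) ^+ r) f.
Proof.
move=> x1f x2f df; rewrite -mulrA.
apply: (coprime_principal_ideal (t := at_x1_0)) => //.
- exact: mpolyX_neq0.
- apply: ord2_cases; rewrite (tnth_nth 0) /=.
    by rewrite subr0; exists 1; rewrite mul1r.
  by rewrite subrr; exists 0; rewrite mul0r.
- exact: x1_at_x1_0.
- rewrite rmorphM !rmorphXn rmorphB /= x1_at_x1_0 x2_at_x1_0 sub0r.
  by rewrite mulf_neq0 ?expf_neq0 ?oppr_eq0 ?mpolyX_neq0.
apply: (coprime_principal_ideal (t := at_x2_0)) => //.
- exact: mpolyX_neq0.
- apply: ord2_cases; rewrite (tnth_nth 0) /=.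
    by rewrite subrr; exists 0; rewrite mul0r.
  by rewrite subr0; exists 1; rewrite mul1r.
- exact: x2_at_x2_0.
- rewrite !rmorphXn rmorphB /= x1_at_x2_0 x2_at_x2_0 subr0.
  by rewrite expf_neq0 ?mpolyX_neq0.
Qed.

Lemma msizeM_leS f g m n : (msize f <= m.+1)%N -> (msize g <= n.+1)%N ->
  (msize (f * g) <= (m + n).+1)%N.
Proof.
have [->|f0] := eqVneq f 0; first by rewrite mul0r msize0.
have [->|g0] := eqVneq g 0; first by rewrite mulr0 msize0.
by rewrite msizeM //; move: (msize f) (msize g) => u v; lia.
Qed.

Lemma msizeB_le f g n : (msize f <= n)%N -> (msize g <= n)%N ->
  (msize (f - g) <= n)%N.
Proof.
move=> fn gn; apply: leq_trans (msizeD_le _ _) _.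
by rewrite mmeasureN geq_max fn.
Qed.

Lemma msize_sum_le (I : Type) (s : seq I) (P : pred I) (F : I -> S) n :
    (forall i, P i -> msize (F i) <= n)%N ->
  (msize (\sum_(i <- s | P i) F i) <= n)%N.
Proof.
move=> Fn; elim/big_ind: _ => [|f g fn gn|//]; first by rewrite msize0.
by apply: leq_trans (msizeD_le _ _) _; rewrite geq_max fn.
Qed.

Lemma msize_exp f n : f != 0 -> msize (f ^+ n) = ((msize f).-1 * n).+1.
Proof.
move=> f0; elim: n => [|n IHn]; first by rewrite expr0 msize1 muln0.
rewrite exprS msizeM ?expf_neq0 // IHn.
by move: f0; rewrite -msize_poly_eq0; case: (msize f) => // u _; rewrite /= mulnS addnS.
Qed.

End PlanePolynomials.

(** * Degree bounds for the coefficients of theta *)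

Section WeightedDegree.
Variable K : numFieldType.
Local Notation S := {mpoly K[2]}.
Local Notation x1 := (x1 K).
Local Notation x2 := (x2 K).
Implicit Types (f g h : S) (P Q : {poly S}).

(* Total degree at most [n] in [t], [x1] and [x2] together; the subtraction
   truncates to 0 for [n < j], which then forces the coefficient to vanish. *)
Definition wdeg_le n P := forall j, (msize P`_j <= n.+1 - j)%N.

Lemma wdeg_leM m n P Q :
  wdeg_le m P -> wdeg_le n Q -> wdeg_le (m + n) (P * Q).
Proof.
move=> Pm Qn j; rewrite coefM; apply: msize_sum_le => i _.
have := Pm i; have := Qn (j - i)%N; have := ltn_ord i.
(* For nonzero coefficients the bounds force i <= m and j - i <= n, so the truncated subtractions
   are exact and add up. *)
have [->|f0] := eqVneq P`_i 0; first by rewrite mul0r msize0.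
have [->|g0] := eqVneq Q`_(j - i) 0; first by rewrite mulr0 msize0.
rewrite msizeM //; move: f0 g0; rewrite -!msize_poly_eq0.
move: (msize _) (msize _) => u v; lia.
Qed.

Lemma wdeg_le_exp P n : wdeg_le 1 P -> wdeg_le n (P ^+ n).
Proof.
move=> P1; elim: n => [|n IHn]; last by rewrite exprS -add1n; apply: wdeg_leM.
by case=> [|j]; rewrite expr0 coef1 ?msize1 ?msize0.
Qed.

Lemma wdeg_le_XsubC f : (msize f <= 2)%N -> wdeg_le 1 ('X - f%:P).
Proof.
move=> f2 [|[|j]]; rewrite coefB coefX coefC /=.
- by rewrite sub0r mmeasureN.
- by rewrite subr0 msize1.
by rewrite subrr msize0.
Qed.

Lemma msizeXi i : msize ('X_i : S) = 2.
Proof. by rewrite msizeX mdeg1. Qed.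

Lemma wdeg_le_integrand a b c : wdeg_le (c + b + a) (integrand K a b c).
Proof.
apply: wdeg_leM; last by apply/wdeg_le_exp/wdeg_le_XsubC; rewrite msizeXi.
apply: wdeg_leM; last by apply/wdeg_le_exp/wdeg_le_XsubC; rewrite msizeXi.
apply: wdeg_le_exp; rewrite -['X]subr0 -polyC0.
by apply: wdeg_le_XsubC; rewrite msize0.
Qed.

Lemma wdeg_le_primitive n P : wdeg_le n P -> wdeg_le n.+1 (primitive P).
Proof.
move=> Pn [|j]; first by rewrite coef_poly /= msize0.
by rewrite coef_primitiveS subSS (leq_trans (msizeZ_le _ _)).
Qed.

(** Replacing t by a polynomial of degree at most 1 turns the joint degree into the ordinary one. *)
Lemma msize_horner_le n P f :
  wdeg_le n P -> (msize f <= 2)%N -> (msize P.[f] <= n.+1)%N.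
Proof.
move=> Pn f2; rewrite horner_coef; apply: msize_sum_le => i _.
have [->|P0] := eqVneq P`_i 0; first by rewrite mul0r msize0.
have [->|fi0] := eqVneq (f ^+ i) 0; first by rewrite mulr0 msize0.
have f_i : (msize (f ^+ i) <= i.+1)%N.
  have [f0|f0] := eqVneq f 0; last first.
    have f1 : ((msize f).-1 <= 1)%N by move: (msize f) f2 => u; lia.
    by rewrite msize_exp // ltnS (leq_trans (leq_mul f1 (leqnn i))) ?mul1n.
  by move: fi0; rewrite f0 expr0n; case: (i == _ :> nat) => //=; rewrite ?eqxx ?msize1.
have := Pn i; move: P0; rewrite -msize_poly_eq0 => P0 Pi.
have Pi' : (msize P`_i <= (n - i).+1)%N by move: (msize _) P0 Pi => u; lia.
by apply: leq_trans (msizeM_leS Pi' f_i) _; move: (msize _) P0 Pi => u; lia.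
Qed.

Lemma msize_theta a b c i : (msize (theta K a b c 0%R i) <= (a + b + c).+2)%N.
Proof.
have W := wdeg_le_primitive (wdeg_le_integrand a b c).
have -> : (a + b + c = c + b + a)%N by lia.
rewrite mxE; apply: msizeB_le; apply: msize_horner_le => //.
  by rewrite msizeXi.
by rewrite msize0.
Qed.

End WeightedDegree.

(** * The derivations theta *)

Section ThetaFactors.
Variable K : numFieldType.
Local Notation S := {mpoly K[2]}.
Local Notation x1 := (x1 K).
Local Notation x2 := (x2 K).
Local Notation at_x2_0 := (at_x2_0 K).

(** The endpoints 0 and [x1] are roots of orders [c] and [b]. On x2 = 0 the cofactor is x1^a times
    the beta integral of X^(c+a) (X-1)^b. *)
Lemma theta_x1 a b c : exists2 F,
  theta K a b c 0 0 = x1 ^+ (b + c).+1 * F & F \mPo at_x2_0 != 0.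
Proof.
exists (integral 0 1
  ('X^c * ('X - 1) ^+ b * (('X - x2%:P) ^+ a \Po (x1%:P * 'X)))).
  by rewrite mxE addnC -integral_two_roots0.
rewrite rmorph_integral_two_roots /= x1_at_x2_0 x2_at_x2_0 integral_betaX.
by rewrite mulf_neq0 ?beta_neq0 ?expf_neq0 ?mpolyX_neq0.
Qed.

(** Here the endpoint [x2] is a root of order [a]. The cofactor survives on x2 = 0, as (-x1)^b times
    the beta integral of X^c (X-1)^a. *)
Lemma theta_x2 a b c : exists2 G,
  theta K a b c 0 1 = x2 ^+ (a + c).+1 * G & G \mPo at_x2_0 != 0.
Proof.
exists (integral 0 1
  ('X^c * ('X - 1) ^+ a * (('X - x1%:P) ^+ b \Po (x2%:P * 'X)))).
  by rewrite mxE addnC -integral_two_roots0 /integrand mulrAC.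
rewrite rmorph_integral_two_roots /= x1_at_x2_0 x2_at_x2_0 integral_betaC.
by rewrite mulf_neq0 ?beta_neq0 ?expf_neq0 ?oppr_eq0 ?mpolyX_neq0.
Qed.

(** The difference of the two components is the integral from [x2] to [x1], whose endpoints are
    roots of orders [a] and [b]. *)
Lemma theta_x1Bx2 a b c : in_principal_ideal ((x1 - x2) ^+ (a + b).+1)
  (theta K a b c 0 0 - theta K a b c 0 1).
Proof.
have -> : theta K a b c 0 0 - theta K a b c 0 1 =
    integral x2 x1 (integrand K a b c).
  by rewrite !mxE /integral opprB addrA subrK.
have -> : integrand K a b c =
    ('X - x2%:P) ^+ a * ('X - x1%:P) ^+ b * 'X^c.
  by rewrite /integrand mulrC mulrCA mulrC -mulrA mulrCA mulrA [X in X * _]mulrC.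
by rewrite integral_two_roots mulrC; eexists; reflexivity.
Qed.

End ThetaFactors.

(** * Saito's criterion *)

Section Saito.
Variable K : numFieldType.
Local Notation S := {mpoly K[2]}.
Local Notation x1 := (x1 K).
Local Notation x2 := (x2 K).
Implicit Types e f v : 'rV[S]_2.

Lemma logder_arrA2P p q r v : logder (arrA2 K p q r) v <->
  [/\ in_principal_ideal (x1 ^+ p) (v 0 0),
      in_principal_ideal (x2 ^+ q) (v 0 1)
    & in_principal_ideal ((x1 - x2) ^+ r) (v 0 0 - v 0 1)].
Proof.
have dB : der_app v (x1 - x2) = v 0 0 - v 0 1.
  rewrite -!der_appX /der_app -sumrB; apply: eq_bigr => i _.
  by rewrite mderivB mulrBr.
split=> [Dv|[v1 v2 v12] H].
  split; last by rewrite -dB; apply: (Dv (x1 - x2, r)); rewrite !inE eqxx !orbT.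
    by rewrite -der_appX; apply: (Dv (x1, p)); rewrite !inE eqxx.
  by rewrite -der_appX; apply: (Dv (x2, q)); rewrite !inE eqxx orbT.
rewrite !inE => /or3P[] /eqP -> /=; rewrite ?dB //.
  by rewrite der_appX.
by rewrite der_appX.
Qed.

Definition det2 e f : S := e 0 0 * f 0 1 - e 0 1 * f 0 0.

Lemma det2Z x y e f : det2 (x *: e) (y *: f) = x * y * det2 e f.
Proof. by rewrite /det2 !mxE; ring. Qed.

(** For each line the determinant is a combination of the values of [e] and [f] on its linear form;
    for [x1 - x2], subtract one column from the other first. *)
Lemma logder_det2 p q r e f :
    logder (arrA2 K p q r) e -> logder (arrA2 K p q r) f ->
  in_principal_ideal (defining_poly (arrA2 K p q r)) (det2 e f).
Proof.
move=> /logder_arrA2P[e1 e2 e12] /logder_arrA2P[f1 f2 f12].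
rewrite defining_poly_arrA2; apply: in_principal_ideal_arrA2.
- have -> : det2 e f = f 0 1 * e 0 0 + (- e 0 1) * f 0 0 by rewrite /det2; ring.
  by apply: in_principal_idealD; apply: in_principal_idealMl.
- have -> : det2 e f = e 0 0 * f 0 1 + (- f 0 0) * e 0 1 by rewrite /det2; ring.
  by apply: in_principal_idealD; apply: in_principal_idealMl.
have -> : det2 e f =
    f 0 1 * (e 0 0 - e 0 1) + (- e 0 1) * (f 0 0 - f 0 1) by rewrite /det2; ring.
by apply: in_principal_idealD; apply: in_principal_idealMl.
Qed.

Lemma x1Bx2_neq0 : x1 - x2 != 0.
Proof.
apply/eqP => /(congr1 (comp_mpoly (at_x2_0 K))).
rewrite rmorphB rmorph0 /= x1_at_x2_0 x2_at_x2_0 subr0 => /eqP.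
by rewrite (negPf (mpolyX_neq0 _ _)).
Qed.

Lemma msize_x1Bx2 : msize (x1 - x2) = 2.
Proof.
apply/eqP; rewrite eqn_leq msizeB_le ?msizeXi //= ltnNge.
(* Otherwise [x1 - x2] would be constant, yet it restricts to [x1] on x2 = 0. *)
apply/negP => /msize1_polyC; set k := _@_0 => e.
have := congr1 (comp_mpoly (at_x2_0 K)) e; rewrite comp_mpolyC.
rewrite rmorphB /= x1_at_x2_0 x2_at_x2_0 subr0 => /(congr1 (fun f : S => msize f)).
by rewrite msizeXi msizeC; case: (k == 0).
Qed.

Lemma msize_defining_poly p q r :
  msize (defining_poly (arrA2 K p q r)) = (p + q + r).+1.
Proof.
rewrite defining_poly_arrA2.
have [x10 x20] := (mpolyX_neq0 K 0, mpolyX_neq0 K 1).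
have d0 := x1Bx2_neq0.
rewrite !msizeM ?mulf_neq0 ?expf_neq0 // !msize_exp // !msizeXi msize_x1Bx2; lia.
Qed.

Lemma defining_poly_neq0 p q r : defining_poly (arrA2 K p q r) != 0.
Proof. by rewrite -msize_poly_eq0 msize_defining_poly. Qed.

Lemma saito_criterion p q r e f :
    logder (arrA2 K p q r) e -> logder (arrA2 K p q r) f ->
    det2 e f != 0 -> (msize (det2 e f) <= (p + q + r).+1)%N ->
  is_basis (logder (arrA2 K p q r)) [tuple e; f].
Proof.
move=> De Df ef0 szef; split.
- by apply: ord2_cases; rewrite (tnth_nth 0).
- move=> c; rewrite big_ord_recl big_ord1 !(tnth_nth 0) /= => ce.
  have {}ce i : c 0 * e 0 i + c 1 * f 0 i = 0.
    have := congr1 (fun w : 'rV[S]_2 => w 0 i) ce; rewrite !mxE => <-.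
    by congr (_ + c _ * _); apply: val_inj.
  have [ce0 ce1] := (ce 0, ce 1).
  (* Eliminating the other unknown from the two scalar relations leaves [c i] times the determinant
     equal to 0. *)
  apply: ord2_cases; apply: (mulIf ef0); rewrite mul0r /det2.
    transitivity ((c 0 * e 0 0 + c 1 * f 0 0) * f 0 1
                  - (c 0 * e 0 1 + c 1 * f 0 1) * f 0 0); first by ring.
    by rewrite ce0 ce1 !mul0r subr0.
  transitivity ((c 0 * e 0 1 + c 1 * f 0 1) * e 0 0
                - (c 0 * e 0 0 + c 1 * f 0 0) * e 0 1); first by ring.
  by rewrite ce0 ce1 !mul0r subr0.
move=> v Dv.
have [h def_ef] := logder_det2 De Df.
have [h1 def1] := logder_det2 Dv Df.
have [h2 def2] := logder_det2 De Dv.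
set Q := defining_poly _ in def_ef def1 def2.
have Q0 : Q != 0 := defining_poly_neq0 p q r.
have h0 : h != 0 by apply: contraNneq ef0 => h0; rewrite def_ef h0 mul0r.
(* Q already has degree p + q + r, so the degree bound makes the quotient [h] a constant, hence
   invertible. *)
have /msize1_polyC def_h : (msize h <= 1)%N.
  by move: szef; rewrite def_ef msizeM // msize_defining_poly; move: (msize h) => u; lia.
set k := h@_0 in def_h.
have k0 : k != 0 by apply: contraNneq h0 => k0; rewrite def_h k0 mpolyC0.
(* Cramer's rule: the coordinates of [v] are det(v,f)/det(e,f) and det(e,v)/det(e,f), where Q
   cancels and [h] equals [k]. *)
exists (fun i => k^-1%:MP * (if i == 0 then h1 else h2)).
apply/rowP => i; rewrite big_ord_recl big_ord1 !(tnth_nth 0) /= !mxE.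
have cramer : v 0 i * det2 e f = det2 v f * e 0 i + det2 e v * f 0 i.
  by move: i; apply: ord2_cases; rewrite /det2; ring.
have kV : k^-1%:MP * h = 1 by rewrite def_h -mpolyCM mulVf.
apply: (mulIf Q0); rewrite -[LHS]mul1r -kV.
transitivity (k^-1%:MP * (v 0 i * (h * Q))); first by ring.
by rewrite -def_ef cramer def1 def2; ring.
Qed.

End Saito.

(** * The two bases *)

(** The multiplicities come from solving the formulas for (a,b,c). The components have degrees at
    most a+b+c+1 and a+b+c+2, which sum to p+q+r. *)
Lemma theta_basis_odd (K : numFieldType) (a b c : nat) :
  is_basis (logder (arrA2 K (b + c).+1 (a + c).+1 (a + b).+1))
    [tuple theta K a b c; theta K a b c.+1].
Proof.
have [F1 def11 F10] := theta_x1 K a b c.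
have [G1 def12 G10] := theta_x2 K a b c.
have [F2 def21 F20] := theta_x1 K a b c.+1.
have [G2 def22 G20] := theta_x2 K a b c.+1.
have H1 := theta_x1Bx2 K a b c; have H2 := theta_x1Bx2 K a b c.+1.
have sz i := msize_theta K a b c i; have sz' i := msize_theta K a b c.+1 i.
have x10 := mpolyX_neq0 K 0; have x20 := mpolyX_neq0 K 1.
move: (theta K a b c) (theta K a b c.+1) def11 def12 def21 def22 H1 H2 sz sz'.
rewrite !addnS !(exprS _ _.+1) => e f.
set X := x1 K ^+ _; set Y := x2 K ^+ _ => def11 def12 def21 def22 H1 H2 sz sz'.
apply: saito_criterion.
- apply/logder_arrA2P; split; last exact: H1.
    by exists F1; rewrite def11 mulrC.
  by exists G1; rewrite def12 mulrC.
- apply/logder_arrA2P; split; last exact: H2.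
    by exists (x1 K * F2); rewrite def21 mulrAC.
  by exists (x2 K * G2); rewrite def22 mulrAC.
- rewrite /det2 def11 def12 def21 def22.
  (* The second derivation has one extra [x1] and [x2] in its components, so on x2 = 0 the bracket
     reduces to - x1 G1 F2. *)
  have -> : X * F1 * (x2 K * Y * G2) - Y * G1 * (x1 K * X * F2) =
      X * Y * (x2 K * F1 * G2 - x1 K * (G1 * F2)) by ring.
  rewrite !mulf_neq0 ?expf_neq0 //; apply/eqP.
  move=> /(congr1 (comp_mpoly (at_x2_0 K))); rewrite rmorph0 rmorphB !rmorphM /=.
  rewrite x1_at_x2_0 x2_at_x2_0 !mul0r sub0r => /eqP; rewrite oppr_eq0.
  by apply/negP; rewrite mulf_neq0 ?mulf_neq0.
apply: leq_trans (msizeB_le (msizeM_leS (sz _) (sz' _)) (msizeM_leS (sz _) (sz' _))) _.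
by lia.
Qed.

(** Here [a] and [b] are the smaller exponents a' and b of the two triples. The first theta lacks
    exactly one factor [x1] in its first component and the second one factor [x2] in its second; the
    multipliers supply them. *)
Lemma theta_basis_even (K : numFieldType) (a b c : nat) :
  is_basis (logder (arrA2 K (b + c).+2 (a + c).+2 (a + b).+2))
    [tuple x1 K *: theta K a.+1 b c; x2 K *: theta K a b.+1 c].
Proof.
have [F1 def11 F10] := theta_x1 K a.+1 b c.
have [G1 def12 G10] := theta_x2 K a.+1 b c.
have [F2 def21 F20] := theta_x1 K a b.+1 c.
have [G2 def22 G20] := theta_x2 K a b.+1 c.
have [H1 def1] := theta_x1Bx2 K a.+1 b c.
have [H2 def2] := theta_x1Bx2 K a b.+1 c.
have sz i := msize_theta K a.+1 b c i; have sz' i := msize_theta K a b.+1 c i.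
have x10 := mpolyX_neq0 K 0; have x20 := mpolyX_neq0 K 1.
move: (theta K a.+1 b c) (theta K a b.+1 c)
  def11 def12 def21 def22 def1 def2 sz sz'.
rewrite !addSn !addnS !(exprS (x1 K) _.+1) !(exprS (x2 K) _.+1) => e f.
set X := x1 K ^+ _; set Y := x2 K ^+ _ => def11 def12 def21 def22 def1 def2 sz sz'.
apply: saito_criterion.
- apply/logder_arrA2P; rewrite !mxE !(exprS (x1 K) _.+1) !(exprS (x2 K) _.+1) -/X -/Y; split.
  + by exists F1; rewrite def11 mulrA mulrC.
  + by exists (x1 K * G1); rewrite def12; ring.
  by exists (x1 K * H1); rewrite -mulrBr def1 mulrA.
- apply/logder_arrA2P; rewrite !mxE !(exprS (x1 K) _.+1) !(exprS (x2 K) _.+1) -/X -/Y; split.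
  + by exists (x2 K * F2); rewrite def21 mulrA mulrAC.
  + by exists G2; rewrite def22; ring.
  by exists (x2 K * H2); rewrite -mulrBr def2 mulrA.
- rewrite det2Z /det2 def11 def12 def21 def22.
  (* On x2 = 0 the bracket reduces to F1 G2. *)
  have -> : X * F1 * (Y * G2) - x2 K * Y * G1 * (x1 K * X * F2) =
      X * Y * (F1 * G2 - x2 K * (x1 K * (G1 * F2))) by ring.
  do 2?[rewrite mulf_neq0 ?mulf_neq0 ?expf_neq0 //]; apply/eqP.
  move=> /(congr1 (comp_mpoly (at_x2_0 K))); rewrite rmorph0 rmorphB !rmorphM /=.
  rewrite x2_at_x2_0 !mul0r subr0 => /eqP.
  by apply/negP; rewrite mulf_neq0.
have sz_x i : (msize ('X_i : {mpoly K[2]}) <= 2)%N by rewrite msizeXi.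
rewrite det2Z; apply: leq_trans (msizeM_leS (msizeM_leS (sz_x 0) (sz_x 1))
  (msizeB_le (msizeM_leS (sz _) (sz' _)) (msizeM_leS (sz _) (sz' _)))) _.
by lia.
Qed.

Theorem theorem2p3 (R : realType) (p q r : nat)
    (p_gt0 : (0 < p)%N) (q_gt0 : (0 < q)%N)
    (max_le_r : (maxn p q <= r)%N) (r_le : (r <= p + q - 1)%N) :
  (odd (p + q + r) ->
     let a := ((q + r - p - 1) %/ 2)%N in
     let b := ((p + r - q - 1) %/ 2)%N in
     let c := ((p + q - r - 1) %/ 2)%N in
     is_basis (logder (arrA2 R[i] p q r))
       [tuple theta R[i] a b c; theta R[i] a b c.+1])
  /\
  (~~ odd (p + q + r) ->
     let a := ((q + r - p) %/ 2)%N in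
     let b := ((p + r - q - 2) %/ 2)%N in
     let c := ((p + q - r - 2) %/ 2)%N in
     let a' := ((q + r - p - 2) %/ 2)%N in
     let b' := ((p + r - q) %/ 2)%N in
     let c' := ((p + q - r - 2) %/ 2)%N in
     is_basis (logder (arrA2 R[i] p q r))
       [tuple x1 R[i] *: theta R[i] a b c; x2 R[i] *: theta R[i] a' b' c']).
Proof.
split=> [podd a b c|peven a b c a' b' c'].
  (* The bounds on [r] make the truncated subtractions exact, and the parity makes the halvings
     exact. *)
  have -> : p = (b + c).+1 by rewrite /b /c; lia.
  have -> : q = (a + c).+1 by rewrite /a /c; lia.
  have -> : r = (a + b).+1 by rewrite /a /b; lia.
  exact: theta_basis_odd.
(* The bounds make the three differences at least 1, and evenness lifts this to 2, so subtracting 2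
   does not truncate. *)
have -> : c' = c by [].
have -> : a = a'.+1 by rewrite /a /a'; lia.
have -> : b' = b.+1 by rewrite /b /b'; lia.
have -> : p = (b + c).+2 by rewrite /b /c; lia.
have -> : q = (a' + c).+2 by rewrite /a' /c; lia.
have -> : r = (a' + b).+2 by rewrite /a' /b; lia.
exact: theta_basis_even.
Qed.
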